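(* Under the assumptions on $f$, $r$, $\lambda$, $\tau$, $\delta$ listed in the context, let $\{\mathbf{X}_t\}$ be the sequence generated by the accelerated algorithm FaNCL-acc (described in the context), let $c_1=\frac{\tau-\rho}{4}$, and let $\mathbf{C}_t=\mathbf{Y}_t$ if at iteration $t$ the accelerated candidate is accepted (i.e. $\mathbf{X}_{t+1}=\mathbf{X}^a_{t+1}$ is executed), and $\mathbf{C}_t=\mathbf{X}_t$ otherwise. Then for every $T\ge1$, $$\min_{t=1,\dots,T}\|\mathbf{X}_{t+1}-\mathbf{C}_t\|_F^2\le\frac{F(\mathbf{X}_1)-\inf F}{\min(c_1,\delta/2)\,T}.$$
   Context: Problem: minimize $F(\mathbf{X})=f(\mathbf{X})+\lambda r(\mathbf{X})$ over $\mathbf{X}\in\mathbb{R}^{m\times n}$, $\lambda>0$. Assumptions. (A1) $f:\mathbb{R}^{m\times n}\to\mathbb{R}$ is differentiable (not necessarily convex) with $\rho$-Lipschitz gradient: $\|\nabla f(\mathbf{X}_1)-\nabla f(\mathbf{X}_2)\|_F\le\rho\|\mathbf{X}_1-\mathbf{X}_2\|_F$, $\rho\le1$. (A2) $\inf f>-\infty$ and $f(\mathbf{X})\to\infty$ as $\|\mathbf{X}\|_F\to\infty$. (A3) $r(\mathbf{X})=\sum_i\hat r(\sigma_i(\mathbf{X}))$, where $\sigma_i(\mathbf{X})$ is the $i$-th largest singular value and $\hat r:[0,\infty)\to\mathbb{R}$ is concave and non-decreasing with $\hat r(0)=0$. Fix $\tau>\rho$, $\delta>0$ and $c_1=\frac{\tau-\rho}{4}$.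 Threshold: $\gamma>0$ is a number such that $y=0$ minimizes $\frac12(y-\sigma)^2+\mu\hat r(y)$ over $y\ge0$ whenever $0\le\sigma\le\gamma$, where $\mu=\lambda/\tau$. $\mathrm{QR}(\mathbf{A})$ denotes the matrix with orthonormal columns from a QR decomposition of $\mathbf{A}$. PowerMethod$(\mathbf{Z},\mathbf{R})$, $\mathbf{Z}\in\mathbb{R}^{m\times n}$, $\mathbf{R}\in\mathbb{R}^{n\times k}$, $J=3$: $\mathbf{Y}_1=\mathbf{Z}\mathbf{R}$; for $j=1,\dots,J$: $\mathbf{Q}_j=\mathrm{QR}(\mathbf{Y}_j)$, $\mathbf{Y}_{j+1}=\mathbf{Z}(\mathbf{Z}^\top\mathbf{Q}_j)$; return $\mathbf{Q}_J$. ApproxGSVT$(\mathbf{Z},\mathbf{R},\mu)$: $\mathbf{Q}=$ PowerMethod$(\mathbf{Z},\mathbf{R})$; compute the SVD $\mathbf{U}\mathbf{\Sigma}\mathbf{V}^\top$ of $\mathbf{Q}^\top\mathbf{Z}$; $a=$ number of $\Sigma_{ii}>\gamma$; $\mathbf{U}_a,\mathbf{V}_a=$ the $a$ leading columns of $\mathbf{U},\mathbf{V}$; $y_i^*\in\operatorname{Arg\,min}_{y\ge0}\frac12(y-\Sigma_{ii})^2+\mu\hat r(y)$ for $i\le a$; return $\tilde{\mathbf{X}}=\mathbf{Q}\mathbf{U}_a\operatorname{Diag}(y_1^*,\dots,y_a^* )\mathbf{V}_a^\top$ and $\mathbf{V}$. InexactPS$(\mathbf{X},\mathbf{R})$: $\mathbf{X}_{\rm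 gd}=\mathbf{X}-\frac1\tau\nabla f(\mathbf{X})$; $\tilde{\mathbf{V}}_0=\mathbf{R}$; for $p=1,2,\dots$: $[\tilde{\mathbf{X}}_p,\tilde{\mathbf{V}}_p]=$ ApproxGSVT$(\mathbf{X}_{\rm gd},\tilde{\mathbf{V}}_{p-1},\lambda/\tau)$, stopping as soon as $F(\tilde{\mathbf{X}}_p)\le F(\mathbf{X})-c_1\|\tilde{\mathbf{X}}_p-\mathbf{X}\|_F^2$; return $\tilde{\mathbf{X}}_p,\tilde{\mathbf{V}}_p$. FaNCL-acc: $\mathbf{V}_0,\mathbf{V}_1\in\mathbb{R}^{n}$ random Gaussian, $\mathbf{X}_0=\mathbf{X}_1=0$, $\alpha_0=\alpha_1=1$; for $t=1,2,\dots$: $\mathbf{Y}_t=\mathbf{X}_t+\frac{\alpha_{t-1}-1}{\alpha_t}(\mathbf{X}_t-\mathbf{X}_{t-1})$; $\mathbf{R}_t=\mathrm{QR}([\mathbf{V}_t,\mathbf{V}_{t-1}])$; $\mathbf{X}^a_{t+1}=$ InexactPS$(\mathbf{Y}_t,\mathbf{R}_t)$; if $F(\mathbf{X}^a_{t+1})\le F(\mathbf{X}_t)-\frac\delta2\|\mathbf{X}^a_{t+1}-\mathbf{Y}_t\|_F^2$ then $\mathbf{X}_{t+1}=\mathbf{X}^a_{t+1}$, else $\mathbf{X}_{t+1}=$ InexactPS$(\mathbf{X}_t,\mathbf{R}_t)$; $\mathbf{V}_{t+1}$ is the second output of the InexactPS call that produced $\mathbf{X}_{t+1}$; $\alpha_{t+1}=\frac12(\sqrt{4\alpha_t^2+1}+1)$.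 The sequence $\{\mathbf{X}_t\}$ being generated means that every call to InexactPS terminates. *)

(* Defs.v *)
From HB Require Import structures.
From mathcomp Require Import all_boot all_order all_algebra.
From mathcomp Require Import all_classical all_reals all_analysis.

Set Implicit Arguments.
Unset Strict Implicit.
Unset Printing Implicit Defensive.

Import Order.TTheory GRing.Theory Num.Theory.
Import numFieldNormedType.Exports.

Local Open Scope classical_set_scope.
Local Open Scope ring_scope.

(* The library norm `|A| on matrices is the maximum norm. *)
Definition frob (R : realType) m n (A : 'M[R]_(m, n)) : R :=
  Num.sqrt (\sum_i \sum_j A i j ^+ 2).

Definition gradient (R : realType) m n (f : 'M[R]_(m, n) -> R)
    (X : 'M[R]_(m, n)) : 'M[R]_(m, n) :=
  \matrix_(i, j) 'd (f : 'M[R]_(m, n) -> R^o) X (delta_mx i j).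

(* Economy-size factorizations. The inner dimension is a variable constrained
   by an equation, so that no casts between equal dimensions are needed. *)
Definition is_qr (R : realType) m k q (A : 'M[R]_(m, k)) (Q : 'M[R]_(m, q)) :=
  [/\ q = minn m k, Q^T *m Q = 1%:M &
      exists2 T : 'M[R]_(q, k),
        (forall (i : 'I_q) (j : 'I_k), (j < i)%N -> T i j = 0) & A = Q *m T].

Definition is_svd (R : realType) m n s (A : 'M[R]_(m, n))
    (U : 'M[R]_(m, s)) (S : 'rV[R]_s) (V : 'M[R]_(n, s)) :=
  [/\ s = minn m n, U^T *m U = 1%:M, V^T *m V = 1%:M,
      (forall i, 0 <= S 0 i) /\
      (forall i j : 'I_s, (i <= j)%N -> S 0 j <= S 0 i) &
      A = U *m diag_mx S *m V^T].

(* Every A has an SVD, and its diagonal S is unique: the default value 0 is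
   never used. *)
Definition singular_values (R : realType) m n (A : 'M[R]_(m, n)) :
    'rV[R]_(minn m n) :=
  xget 0 [set S | exists U V, is_svd A U S V].

Definition lead_cols (R : realType) m s a (h : (a <= s)%N) (U : 'M[R]_(m, s)) :
    'M[R]_(m, a) :=
  colsub (widen_ord h) U.

Definition regularizer (R : realType) m n (rhat : R -> R)
    (X : 'M[R]_(m, n)) : R :=
  \sum_(i < minn m n) rhat (singular_values X 0 i).

Definition objective (R : realType) m n (f : 'M[R]_(m, n) -> R)
    (rhat : R -> R) (lambda : R) (X : 'M[R]_(m, n)) : R :=
  f X + lambda * regularizer rhat X.

Definition smooth_loss (R : realType) m n (f : 'M[R]_(m, n) -> R) (rho : R) :=
  [/\ forall X, differentiable (f : 'M[R]_(m, n) -> R^o) X,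
      forall X1 X2, frob (gradient f X1 - gradient f X2) <= rho * frob (X1 - X2)
    & rho <= 1].

Definition coercive_loss (R : realType) m n (f : 'M[R]_(m, n) -> R) :=
  has_lbound (range f) /\
  (forall M : R, exists K : R, forall X, K <= frob X -> M <= f X).

(* Only the values of rhat on [0, +oo[ matter. *)
Definition concave_penalty (R : realType) (rhat : R -> R) :=
  [/\ convex_function (`[0, +oo[ : set R^o) (fun x : R^o => - rhat x),
      {in `[0, +oo[ &, {homo rhat : x y / x <= y}} & rhat 0 = 0].

Definition prox_argmin (R : realType) (mu : R) (rhat : R -> R) (sigma y : R) :=
  let h z := (z - sigma) ^+ 2 / 2 + mu * rhat z in
  0 <= y /\ (forall z, 0 <= z -> h y <= h z).

Definition prox_threshold (R : realType) (mu : R) (rhat : R -> R) (gamma : R) :=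
  0 < gamma /\
  (forall sigma, 0 <= sigma <= gamma -> prox_argmin mu rhat sigma 0).

(* QR, SVD and Arg min do not determine their results, so the algorithms are
   relations between inputs and possible outputs. *)

Inductive power_method (R : realType) m n k q (Z : 'M[R]_(m, n))
    (Rm : 'M[R]_(n, k)) : nat -> 'M[R]_(m, q) -> Prop :=
| PowerInit Q : is_qr (Z *m Rm) Q -> power_method Z Rm 1 Q
| PowerStep J Q Q' : power_method Z Rm J Q ->
    is_qr (Z *m (Z^T *m Q)) Q' -> power_method Z Rm J.+1 Q'.

Definition approx_gsvt (R : realType) m n k s (rhat : R -> R) (gamma : R)
    (Z : 'M[R]_(m, n)) (Rm : 'M[R]_(n, k)) (mu : R)
    (Xout : 'M[R]_(m, n)) (V : 'M[R]_(n, s)) :=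
  exists q (Q : 'M[R]_(m, q)) (U : 'M[R]_(q, s)) (S : 'rV[R]_s)
         (a : nat) (h : (a <= s)%N) (y : 'rV[R]_a),
    [/\ power_method Z Rm 3 Q,
        is_svd (Q^T *m Z) U S V,
        a = #|[set i | gamma < S 0 i]%SET|,
        forall i : 'I_a, prox_argmin mu rhat (S 0 (widen_ord h i)) (y 0 i)
      & Xout = Q *m lead_cols h U *m diag_mx y *m (lead_cols h V)^T].

(* An inhabitant is a terminating run of the loop. *)
Inductive inexact_ps (R : realType) m n (f : 'M[R]_(m, n) -> R)
    (rhat : R -> R) (lambda tau c1 gamma : R) (X : 'M[R]_(m, n)) :
    forall k, 'M[R]_(n, k) -> 'M[R]_(m, n) -> forall s, 'M[R]_(n, s) -> Prop :=
| PSStop k (Rm : 'M[R]_(n, k)) Xp s (Vp : 'M[R]_(n, s)) :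
    approx_gsvt rhat gamma (X - tau^-1 *: gradient f X) Rm (lambda / tau) Xp Vp ->
    objective f rhat lambda Xp <=
      objective f rhat lambda X - c1 * frob (Xp - X) ^+ 2 ->
    inexact_ps f rhat lambda tau c1 gamma X Rm Xp Vp
| PSContinue k (Rm : 'M[R]_(n, k)) Xp s (Vp : 'M[R]_(n, s))
    Xout l (Vout : 'M[R]_(n, l)) :
    approx_gsvt rhat gamma (X - tau^-1 *: gradient f X) Rm (lambda / tau) Xp Vp ->
    ~~ (objective f rhat lambda Xp <=
          objective f rhat lambda X - c1 * frob (Xp - X) ^+ 2) ->
    inexact_ps f rhat lambda tau c1 gamma X Vp Xout Vout ->
    inexact_ps f rhat lambda tau c1 gamma X Rm Xout Vout.

(* alpha 0 = alpha 1 = 1, and the recurrence starts from alpha 1. *)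
Definition alpha (R : realType) (t : nat) : R :=
  iter t.-1 (fun a => (Num.sqrt (4 * a ^+ 2 + 1) + 1) / 2) 1.

Definition extrapolate (R : realType) m n (X : nat -> 'M[R]_(m, n)) (t : nat) :
    'M[R]_(m, n) :=
  X t + ((alpha R t.-1 - 1) / alpha R t) *: (X t - X t.-1).

Definition accepted (R : realType) m n (f : 'M[R]_(m, n) -> R)
    (rhat : R -> R) (lambda delta : R) (X Xa : nat -> 'M[R]_(m, n)) (t : nat) :
    bool :=
  objective f rhat lambda (Xa t.+1) <=
    objective f rhat lambda (X t) -
      delta / 2 * frob (Xa t.+1 - extrapolate X t) ^+ 2.

(* X and Xa are the sequences X_t and X^a_t (the latter for t >= 2); V t is
   the matrix V_t together with its number of columns, which varies with t. *)
Definition fancl_acc (R : realType) m n (f : 'M[R]_(m, n) -> R)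
    (rhat : R -> R) (lambda tau c1 delta gamma : R) (v0 v1 : 'cV[R]_n)
    (X Xa : nat -> 'M[R]_(m, n)) (V : nat -> {k : nat & 'M[R]_(n, k)}) :=
  [/\ V 0%N = existT _ 1%N v0, V 1%N = existT _ 1%N v1, X 0%N = 0, X 1%N = 0 &
  forall t, (1 <= t)%N ->
    exists w (Rt : 'M[R]_(n, w)) l (Va : 'M[R]_(n, l)),
      [/\ is_qr (row_mx (projT2 (V t)) (projT2 (V t.-1))) Rt,
          inexact_ps f rhat lambda tau c1 gamma (extrapolate X t) Rt
            (Xa t.+1) Va
        & if accepted f rhat lambda delta X Xa t then
            X t.+1 = Xa t.+1 /\ V t.+1 = existT _ l Va
          else
            inexact_ps f rhat lambda tau c1 gamma (X t) Rt
              (X t.+1) (projT2 (V t.+1))]].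

Definition base_point (R : realType) m n (f : 'M[R]_(m, n) -> R)
    (rhat : R -> R) (lambda delta : R) (X Xa : nat -> 'M[R]_(m, n)) (t : nat) :
    'M[R]_(m, n) :=
  if accepted f rhat lambda delta X Xa t then extrapolate X t else X t.

(* Main.v *)
(* Whichever candidate is kept, the acceptance test or the stopping rule of
   InexactPS gives the sufficient decrease
   min(c1, delta/2) |X_(t+1) - C_t|^2 <= F(X_t) - F(X_(t+1)).
   Telescoping bounds the sum of the squared steps by F(X_1) - inf F, where F is
   bounded below because f is and the penalty is nonnegative. *)
Require Import Defs.
From HB Require Import structures.
From mathcomp Require Import all_boot all_order all_algebra.
From mathcomp Require Import all_classical all_reals all_analysis.

Set Implicit Arguments.
Unset Strict Implicit.
Unset Printing Implicit Defensive.

Import Order.TTheory GRing.Theory Num.Theory.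
Import numFieldNormedType.Exports.

Local Open Scope classical_set_scope.
Local Open Scope ring_scope.

(** Both cases of [xget] are nonnegative: the diagonal of an SVD by definition, the default value
    because it is 0. *)
Lemma singular_values_ge0 (R : realType) m n (A : 'M[R]_(m, n)) i :
  0 <= singular_values A 0 i.
Proof.
rewrite /singular_values; case: xgetP => [S _ [U [V []]]|_]; last by rewrite mxE.
by move=> _ _ _ [S_ge0 _] _; exact: S_ge0.
Qed.

Lemma regularizer_ge0 (R : realType) m n (rhat : R -> R) (A : 'M[R]_(m, n)) :
  concave_penalty rhat -> 0 <= regularizer rhat A.
Proof.
move=> [_ rhat_homo rhat0]; apply: sumr_ge0 => i _.
by rewrite -rhat0 rhat_homo ?in_itv/= ?lexx ?singular_values_ge0.
Qed.

Lemma objective_has_lbound (R : realType) m n (f : 'M[R]_(m, n) -> R)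
    (rhat : R -> R) (lambda : R) :
  0 <= lambda -> has_lbound (range f) -> concave_penalty rhat ->
  has_lbound (range (objective f rhat lambda)).
Proof.
move=> lambda_ge0 [b fb] rhatP; exists b => _ [A _ <-].
by rewrite (le_trans (fb (f A) _)) ?lerDl ?mulr_ge0 ?regularizer_ge0//; exists A.
Qed.

(** By induction on the run: [PSContinue] changes only the matrix passed to the power method and
    keeps [X], so the test passed at the final [PSStop] is already the claim. *)
Lemma inexact_ps_decrease (R : realType) m n (f : 'M[R]_(m, n) -> R)
    (rhat : R -> R) (lambda tau c1 gamma : R) (X : 'M[R]_(m, n))
    k (Rm : 'M[R]_(n, k)) (Xout : 'M[R]_(m, n)) s (V : 'M[R]_(n, s)) :
  inexact_ps f rhat lambda tau c1 gamma X Rm Xout V ->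
  objective f rhat lambda Xout <=
    objective f rhat lambda X - c1 * frob (Xout - X) ^+ 2.
Proof. by elim. Qed.

Lemma fancl_acc_decrease (R : realType) m n (f : 'M[R]_(m, n) -> R)
    (rhat : R -> R) (lambda tau c1 delta gamma : R) (v0 v1 : 'cV[R]_n)
    (X Xa : nat -> 'M[R]_(m, n)) (V : nat -> {k : nat & 'M[R]_(n, k)}) (t : nat) :
  fancl_acc f rhat lambda tau c1 delta gamma v0 v1 X Xa V -> (1 <= t)%N ->
  Num.min c1 (delta / 2)
    * frob (X t.+1 - base_point f rhat lambda delta X Xa t) ^+ 2 <=
  objective f rhat lambda (X t) - objective f rhat lambda (X t.+1).
Proof.
move=> [_ _ _ _ step] /step [w [Rt [l [Va [_ _]]]]].
rewrite /base_point; case: ifPn => [acc [-> _]|_ /inexact_ps_decrease].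
  (* Here the stopping rule of InexactPS would compare with the value at the extrapolated point; the
     acceptance test compares with the value at [X t], with constant [delta / 2]. *)
  rewrite lerBrDr addrC -lerBrDr (le_trans acc)// lerB// ler_wpM2r ?sqr_ge0//.
  by rewrite ge_min lexx orbT.
(* In the fallback InexactPS starts at [X t], so its stopping rule applies with constant [c1]. *)
move=> dec; rewrite lerBrDr addrC -lerBrDr (le_trans dec)// lerB//.
by rewrite ler_wpM2r ?sqr_ge0// ge_min lexx.
Qed.

(** The minimum is below each of the [T] terms. For positive [T] the default [d 1] is one of them;
    for [T = 0] both sides vanish. *)
Lemma mean_ge_bigmin_nat (R : realFieldType) (d : nat -> R) (T : nat) :
  (\big[Num.min/d 1%N]_(1 <= t < T.+1) d t) * T%:R <= \sum_(1 <= t < T.+1) d t.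
Proof.
set mn := \big[_/_]_(_ <= _ < _) _.
rewrite mulr_natr -[X in mn *+ X](subn1 T.+1) -sumr_const_nat.
apply: ler_sum_nat => t tT.
by apply: ge_bigmin_seq; rewrite ?mem_index_iota.
Qed.

Theorem corollary3p11 (R : realType) (m n : nat)
    (m_gt0 : (0 < m)%N) (n_gt0 : (0 < n)%N)
    (f : 'M[R]_(m, n) -> R) (rhat : R -> R)
    (lambda rho tau delta c1 gamma : R)
    (lambda_gt0 : 0 < lambda)
    (A1 : smooth_loss f rho)
    (A2 : coercive_loss f)
    (A3 : concave_penalty rhat)
    (tau_gt_rho : rho < tau)
    (delta_gt0 : 0 < delta)
    (c1E : c1 = (tau - rho) / 4)
    (gammaP : prox_threshold (lambda / tau) rhat gamma)
    (v0 v1 : 'cV[R]_n)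
    (X Xa : nat -> 'M[R]_(m, n)) (V : nat -> {k : nat & 'M[R]_(n, k)})
    (run : fancl_acc f rhat lambda tau c1 delta gamma v0 v1 X Xa V)
    (T : nat) (T_gt0 : (1 <= T)%N) :
  let F := objective f rhat lambda in
  let C := base_point f rhat lambda delta X Xa in
  let d t := frob (X t.+1 - C t) ^+ 2 in
  \big[Num.min/d 1%N]_(1 <= t < T.+1) d t
    <= (F (X 1%N) - inf (range F)) / (Num.min c1 (delta / 2) * T%:R).
Proof.
(* The [let]s of the statement are inside the boolean coercion, out of reach of
   [move=>]. *)
cbv zeta; set F := objective f rhat lambda.
pose d t := frob (X t.+1 - base_point f rhat lambda delta X Xa t) ^+ 2.
rewrite -/(d 1%N) -/d.
have c_gt0 : 0 < Num.min c1 (delta / 2).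
  by rewrite lt_min c1E !divr_gt0 ?subr_gt0.
rewrite ler_pdivlMr ?mulr_gt0 ?ltr0n// mulrCA.
have sum_d : Num.min c1 (delta / 2) * (\sum_(1 <= t < T.+1) d t)
    <= F (X 1%N) - F (X T.+1).
  (* Telescoping yields last minus first, hence the sign changes. *)
  rewrite -[leRHS]opprB -(telescope_sumr (F \o X))// -sumrN mulr_sumr.
  apply: ler_sum_nat => t /andP[t_gt0 _]; rewrite opprB.
  exact: fancl_acc_decrease run t_gt0.
apply: le_trans (le_trans sum_d _).
  by rewrite ler_wpM2l ?(ltW c_gt0)// mean_ge_bigmin_nat.
(* That [inf] is below [F (X T.+1)] relies on [F] being bounded below. *)
rewrite lerB//; apply: ge_inf; last by exists (X T.+1).
by apply: objective_has_lbound => //; [exact: ltW | case: A2].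
Qed.
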